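(* Let $G$ be the Markov parameter matrix of an observable and controllable system $(A,B,C,D)$ of order $n$, and let $\hat G\in\mathbb R^{m\times Tp}$ be arbitrary, with associated matrices $H,L,O,Q$ and $\hat H,\hat L,\hat O,\hat Q$ as in the context. Let $\bar A,\bar B,\bar C$ be the output of the Ho–Kalman algorithm with input $G$ and $\hat A,\hat B,\hat C$ the output with input $\hat G$. Suppose $\sigma_{\min}(L)>0$ and $$\|H-\hat H\|\le\sigma_{\min}(L)/4.$$ Then there exists a unitary (real orthogonal) matrix $S\in\mathbb R^{n\times n}$ such that $$\max\{\|\bar C-\hat CS\|_F,\ \|O-\hat OS\|_F,\ \|\bar B-S^*\hat B\|_F,\ \|Q-S^*\hat Q\|_F\}\le5\sqrt{n\|H-\hat H\|}.$$ Furthermore, the hidden state matrices satisfy $$\|\bar A-S^*\hat AS\|_F\le\frac{50\sqrt{n\|H-\hat H\|}\,\|H\|}{\sigma_{\min}^{3/2}(L)}.$$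
   Context: $\|\cdot\|$ is the spectral norm, $\|\cdot\|_F$ the Frobenius norm, $X^*$ the transpose, $X^\dagger$ the Moore–Penrose inverse. System: $A\in\mathbb R^{n\times n}$, $B\in\mathbb R^{n\times p}$, $C\in\mathbb R^{m\times n}$, $D\in\mathbb R^{m\times p}$, with $(A,B)$ controllable and $(C,A)$ observable (stability is not assumed). Let $T=T_1+T_2+1$ and $G=[D,CB,CAB,\dots,CA^{T-2}B]\in\mathbb R^{m\times Tp}$. For a block matrix $X=[X_1,\dots,X_T]\in\mathbb R^{m\times Tp}$ with $m\times p$ blocks, the $(T_1,T_2+1)$ clipped Hankel matrix $H(X)\in\mathbb R^{mT_1\times p(T_2+1)}$ is the $T_1\times(T_2+1)$ block matrix with $(i,j)$ block $X_{i+j}$. Put $H=H(G)$, $\hat H=H(\hat G)$. $H^-,\hat H^-$ denote the first $pT_2$ columns, and $H^+,\hat H^+$ the last $pT_2$ columns, of $H,\hat H$. Standing assumption: $T_1,T_2$ are such that $H^-$ (the $(T_1,T_2)$ Hankel matrix of $G$) has rank $n$. $L$ and $\hat L$ are the best rank-$n$ approximations (SVD truncated to the top $n$ singular values) of $H^-$ and $\hat H^-$; thus $L=H^-$. $\sigma_{\min}(L)$ is the $n$th largest (smallest nonzero) singular value of $L$. Ho–Kalman algorithm (input $\hat G$): take an SVD $\hat L=\hat U\hat\Sigma\hat V^*$ with $\hat\Sigma\in\mathbb R^{n\times n}$, set $\hat O=\hat U\hat\Sigma^{1/2}\in\mathbb R^{mT_1\times n}$ and $\hat Q=\hat\Sigma^{1/2}\hat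 V^*\in\mathbb R^{n\times pT_2}$; output $\hat C$ = first $m$ rows of $\hat O$, $\hat B$ = first $p$ columns of $\hat Q$, and $\hat A=\hat O^\dagger\hat H^+\hat Q^\dagger$. With input $G$: $L=U\Sigma V^*$, $O=U\Sigma^{1/2}$, $Q=\Sigma^{1/2}V^*$, $\bar C$ = first $m$ rows of $O$, $\bar B$ = first $p$ columns of $Q$, $\bar A=O^\dagger H^+Q^\dagger$. *)

(* Defs.v *)
From HB Require Import structures.
From mathcomp Require Import all_boot all_order all_algebra.
From mathcomp Require Import boolp classical_sets reals.

Set Implicit Arguments.
Unset Strict Implicit.
Unset Printing Implicit Defensive.

Import Order.TTheory GRing.Theory Num.Theory.
Local Open Scope ring_scope.

Section Norms.
Variable R : realType.

Definition frob (a b : nat) (X : 'M[R]_(a, b)) : R :=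
  Num.sqrt (\sum_i \sum_j X i j ^+ 2).

(* Operator norm induced by the Euclidean norms; on a column vector, [frob] is
   the Euclidean norm. *)
Definition spectral_norm (a b : nat) (X : 'M[R]_(a, b)) : R :=
  sup [set frob (X *m v) | v in [set v : 'cV[R]_b | frob v <= 1]]%classic.

End Norms.

Section SingularValues.
Variable R : realType.

(* X = U diag(s) V^T with r singular triples, in nonincreasing order.
   With r = minn a b this is the usual thin SVD, which always exists; with a
   smaller r it is an SVD of a matrix of rank at most r. *)
Record is_svd (a b r : nat) (X : 'M[R]_(a, b))
    (U : 'M[R]_(a, r)) (s : 'rV[R]_r) (V : 'M[R]_(b, r)) : Prop := IsSVD {
  svd_U : U^T *m U = 1%:M;
  svd_V : V^T *m V = 1%:M;
  svd_ge0 : forall i, 0 <= s 0 i;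
  svd_noninc : forall i j : 'I_r, (i <= j)%N -> s 0 j <= s 0 i;
  svd_eq : X = U *m diag_mx s *m V^T
}.

(* All singular values, nonincreasing: the (unique) diagonal of an SVD. *)
Definition singular_values (a b : nat) (X : 'M[R]_(a, b)) : 'rV[R]_(minn a b) :=
  xget 0 [set s | exists U V, is_svd X U s V]%classic.

(* The k-th largest singular value, counted from k = 1; 0 out of range. *)
Definition sigma (a b : nat) (X : 'M[R]_(a, b)) (k : nat) : R :=
  [seq singular_values X 0 i | i <- enum 'I_(minn a b)]`_k.-1.

(* Y is a best rank-n approximation of X. It need not be unique when the n-th
   and (n+1)-st singular values of X coincide, hence a relation. *)
Definition svd_truncation (n a b : nat) (X Y : 'M[R]_(a, b)) : Prop :=
  exists (U : 'M[R]_(a, minn a b)) (s : 'rV[R]_(minn a b))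
         (V : 'M[R]_(b, minn a b)),
    is_svd X U s V /\
    Y = U *m diag_mx (\row_k (if (k < n)%N then s 0 k else 0)) *m V^T.

End SingularValues.

Section MoorePenrose.
Variable R : realType.

Record is_moore_penrose (a b : nat) (X : 'M[R]_(a, b)) (Y : 'M[R]_(b, a)) :
    Prop := IsMoorePenrose {
  mp_XYX : X *m Y *m X = X;
  mp_YXY : Y *m X *m Y = Y;
  mp_symXY : (X *m Y)^T = X *m Y;
  mp_symYX : (Y *m X)^T = Y *m X
}.

Definition mp_inv (a b : nat) (X : 'M[R]_(a, b)) : 'M[R]_(b, a) :=
  xget 0 [set Y | is_moore_penrose X Y]%classic.

End MoorePenrose.

Section LTI.
Variable R : realType.
Variables n m p : nat.
Implicit Types (A : 'M[R]_n) (B : 'M[R]_(n, p)) (C : 'M[R]_(m, n)).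

Definition controllable A B : Prop :=
  \rank (\mxrow_(k < n) (A ^+ k *m B)) = n.

Definition observable A C : Prop :=
  \rank (\mxcol_(k < n) (C *m A ^+ k)) = n.

(* [D, CB, CAB, ..., C A^(T-2) B] *)
Definition markov_params (T : nat) A B C (D : 'M[R]_(m, p)) :
    'M[R]_(m, \sum_(k < T) p) :=
  \mxrow_(k < T) (if k == 0%N :> nat then D else C *m A ^+ k.-1 *m B).

End LTI.

Section Hankel.
Variable R : realType.
Variables m p T1 T2 : nat.

(* With blocks X_1, ..., X_T, T = T1 + T2 + 1, and i, j counted from 1, the
   (i, j) block is X_(i+j). The ordinals here count from 0, which turns this
   into (i+1) + (j+1) - 1 = i + j + 1. *)
Definition hankel (X : 'M[R]_(m, \sum_(k < (T1 + T2).+1) p)) :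
    'M[R]_(\sum_(i < T1) m, \sum_(j < T2.+1) p) :=
  \mxblock_(i < T1, j < T2.+1) submxrow X (inord (i + j).+1).

(* First (resp. last) p * T2 columns: all block columns but the last
   (resp. first) one. *)
Definition hminus (a : nat) (H : 'M[R]_(a, \sum_(j < T2.+1) p)) :
    'M[R]_(a, \sum_(j < T2) p) :=
  \mxrow_(j < T2) submxrow H (lift ord_max j).

Definition hplus (a : nat) (H : 'M[R]_(a, \sum_(j < T2.+1) p)) :
    'M[R]_(a, \sum_(j < T2) p) :=
  \mxrow_(j < T2) submxrow H (lift ord0 j).

End Hankel.

Section HoKalman.
Variable R : realType.
Variables n m p T1 T2 : nat.
Hypotheses (hT1 : (0 < T1)%N) (hT2 : (0 < T2)%N).

(* A run of the Ho-Kalman algorithm on X, with intermediate matrices L, O, Q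
   and output A, B, C. It is a relation since both the truncation and the SVD
   of L involve choices. *)
Definition ho_kalman (X : 'M[R]_(m, \sum_(k < (T1 + T2).+1) p))
    (L : 'M[R]_(\sum_(i < T1) m, \sum_(j < T2) p))
    (O : 'M[R]_(\sum_(i < T1) m, n)) (Q : 'M[R]_(n, \sum_(j < T2) p))
    (A : 'M[R]_n) (B : 'M[R]_(n, p)) (C : 'M[R]_(m, n)) : Prop :=
  svd_truncation n (hminus (hankel X)) L /\
  exists (U : 'M[R]_(\sum_(i < T1) m, n)) (s : 'rV[R]_n)
         (V : 'M[R]_(\sum_(j < T2) p, n)),
    is_svd L U s V /\
    O = U *m diag_mx (map_mx Num.sqrt s) /\
    Q = diag_mx (map_mx Num.sqrt s) *m V^T /\
    C = submxcol O (Ordinal hT1) /\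
    B = submxrow Q (Ordinal hT2) /\
    A = mp_inv O *m hplus (hankel X) *m mp_inv Q.

End HoKalman.

(* Main.v *)
Require Import Defs.
From mathcomp Require Import all_boot all_order all_algebra.
From mathcomp Require Import ring lra.
From mathcomp Require Import boolp classical_sets reals topology normedtype.
From mathcomp Require Import derive exp.

(* The matrices [O; Q^T] and [Ohat; Qhat^T] are balanced factors of L and Lhat:
   O^T O = Q Q^T and Ohat^T Ohat = Qhat Qhat^T. For S the orthogonal polar factor
   of Ohat^T O + Qhat Q^T, an orthogonal Procrustes estimate gives
   sigma_n(L) dist^2 <= 4 |L - Lhat|_F^2, where dist is the Frobenius distance
   from [O; Q^T] to [Ohat; Qhat^T] S. Since L = H^- has rank n, a Weyl-type
   argument (a vector of a span of right singular vectors killed by H^-) gives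
   |L - Lhat| <= 2 |H - Hhat| <= sigma_n(L) / 2, and L - Lhat has rank at most
   2n; together, dist^2 <= 8 n |H - Hhat|. The bound on the state matrix follows
   by telescoping pinv(O) H^+ pinv(Q), with pinv the Moore-Penrose inverse. *)

Set Implicit Arguments.
Unset Strict Implicit.
Unset Printing Implicit Defensive.

Import Order.TTheory GRing.Theory Num.Theory.
Import numFieldNormedType.Exports.
Local Open Scope ring_scope.

Local Notation bil u P v := ((u^T *m P *m v) 0 0).

(** * Polar factors by maximizing a trace over the orthogonal group *)

Section Polar.
Variable R : realType.

Lemma continuous_bigsum (T : topologicalType) (I : finType) (f : I -> T -> R) :
  (forall i, continuous (f i)) -> continuous (fun v => \sum_i f i v).
Proof.
by move=> cf v; apply: cvg_big => [|i _]; [exact: add_continuous | exact: cf].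
Qed.

Lemma vec_mx_coord_continuous m n (i : 'I_m) (j : 'I_n) :
  continuous (fun v : 'rV[R]_(m * n) => vec_mx v i j).
Proof.
rewrite (_ : (fun _ => _) = fun v : 'rV[R]_(m * n) => v 0 (mxvec_index i j)).
  exact: coord_continuous.
by apply/funext => v; rewrite mxE.
Qed.

(** The columns are unit vectors, so every entry is at most 1 in absolute value, and the set is an
    intersection of level sets of continuous functions. Matrices are flattened to row vectors to fit
    [bounded_closed_compact]. *)
Lemma orthogonal_compact n :
  compact [set v : 'rV[R]_(n * n) | (vec_mx v)^T *m vec_mx v = 1%:M]%classic.
Proof.
apply: bounded_closed_compact.
  exists 1; split => // c c1 v /= vO; apply: le_trans (ltW c1).
  rewrite [leLHS]/Num.norm /= mx_normrE; apply/bigmax_leP; split => //= -[i k] _ /=.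
  rewrite (ord1 i); case/mxvec_indexP: k => {}i j.
  have -> : v 0 (mxvec_index i j) = vec_mx v i j by rewrite mxE.
  have := congr1 (fun M : 'M[R]_n => M j j) vO; rewrite !mxE eqxx mulr1n => e.
  rewrite -(@expr_le1 _ 2) // real_normK ?num_real // -e (bigD1 i) //= !mxE -expr2 lerDl.
  by apply: sumr_ge0 => l _; rewrite !mxE -expr2 sqr_ge0.
rewrite [X in closed X](_ : _ = \bigcap_(ij in [set: 'I_n * 'I_n])
  ((fun v : 'rV[R]_(n * n) => \sum_k vec_mx v k ij.1 * vec_mx v k ij.2) @^-1`
    [set x | x = (ij.1 == ij.2)%:R]))%classic; last first.
  apply/seteqP; split => v /=.
    move=> vO [i j] _ /=.
    have := congr1 (fun M : 'M[R]_n => M i j) vO; rewrite !mxE => <-.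
    by apply: eq_bigr => k _; rewrite !mxE.
  move=> vO; apply/matrixP => i j; have /= := vO (i, j) I; rewrite !mxE => <-.
  by apply: eq_bigr => k _; rewrite !mxE.
apply: closed_bigI => -[i j] _; apply: preimage_closed; last exact: closed_eq.
move=> v _; apply: continuous_bigsum => k {}v.
exact: cvgM (@vec_mx_coord_continuous n n k i v) (@vec_mx_coord_continuous n n k j v).
Qed.

(** The Householder reflection in the hyperplane orthogonal to [v]; the identity when [v = 0]. *)
Definition reflection n (v : 'cV[R]_n) : 'M[R]_n :=
  1%:M - (2%:R / (v^T *m v) 0 0) *: (v *m v^T).

Lemma reflectionT n (v : 'cV[R]_n) : (reflection v)^T = reflection v.
Proof. by rewrite /reflection linearB linearZ /= trmx1 trmx_mul trmxK. Qed.

Lemma reflection_orth n (v : 'cV[R]_n) : (v^T *m v) 0 0 != 0 ->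
  (reflection v)^T *m reflection v = 1%:M.
Proof.
move=> q0; rewrite reflectionT /reflection; set q := (v^T *m v) 0 0 in q0 *.
have vv : v *m v^T *m (v *m v^T) = q *: (v *m v^T).
  by rewrite mulmxA -(mulmxA v) [v^T *m v]mx11_scalar mul_mx_scalar scalemxAl.
rewrite mulmxBr mulmx1 mulmxBl mul1mx -scalemxAl -scalemxAr vv !scalerA.
rewrite -scalerBl -addrA -opprD -scalerDl [X in X *: _](_ : _ = 0); last by field.
by rewrite scale0r subr0.
Qed.

Lemma trace_mul_reflection n (P : 'M[R]_n) (v : 'cV[R]_n) :
  \tr (P *m reflection v) = \tr P - 2%:R / (v^T *m v) 0 0 * bil v P v.
Proof.
rewrite /reflection mulmxBr mulmx1 -scalemxAr linearB linearZ /=.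
by rewrite mulmxA mxtrace_mulC mulmxA trace_mx11.
Qed.

Lemma bil_mul_reflection n (P : 'M[R]_n) (u v : 'cV[R]_n) :
  bil v (P *m reflection u) v =
  bil v P v - 2%:R / (u^T *m u) 0 0 * (bil v P u * (u^T *m v) 0 0).
Proof.
rewrite /reflection mulmxBr mulmx1 -scalemxAr mulmxBr mulmxBl -scalemxAr -scalemxAl.
rewrite [LHS]mxE [X in _ + X]mxE [X in - X]mxE; congr (_ - _ * _).
rewrite (_ : v^T *m (P *m (u *m u^T)) *m v = (v^T *m P *m u) *m (u^T *m v)).
  by rewrite mxE big_ord1.
by rewrite !mulmxA.
Qed.

Lemma polar_exists n (M : 'M[R]_n) :
  exists S : 'M[R]_n, [/\ S^T *m S = 1%:M, (M *m S)^T = M *m S &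
    forall v : 'cV[R]_n, 0 <= bil v (M *m S) v].
Proof.
(* S maximizes tr (M S) over the orthogonal group. Comparing with S K, where K
   is a reflection gives positivity, and where K is the product of the
   reflections along e_i and e_i + t e_j with t -> 0 gives symmetry. *)
pose orth := [set v : 'rV[R]_(n * n) | (vec_mx v)^T *m vec_mx v = 1%:M]%classic.
have orth0 : (orth !=set0)%classic.
  by exists (mxvec 1%:M); rewrite /orth /= mxvecK trmx1 mulmx1.
have contf : continuous (fun v : 'rV[R]_(n * n) => \tr (M *m vec_mx v)).
  apply: continuous_bigsum => i; under eq_fun do rewrite mxE.
  apply: continuous_bigsum => j v.
  exact: cvgM (cvg_cst _) (@vec_mx_coord_continuous n n j i v).
have [c] := compact_EVT_max orth0 (@orthogonal_compact n)
  (continuous_subspaceT contf).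
rewrite inE /orth /=; set S := vec_mx c => SO maxS.
pose P := M *m S.
have maxP K : K^T *m K = 1%:M -> \tr (P *m K) <= \tr P.
  move=> KO; rewrite /P -mulmxA -(mxvecK (S *m K)); apply: maxS.
  rewrite inE /= mxvecK trmx_mul mulmxA -(mulmxA K^T) SO mulmx1; exact: KO.
have psd (v : 'cV[R]_n) : 0 <= bil v P v.
  have [v0|v0] := eqVneq ((v^T *m v) 0 0) 0.
    suff -> : v = 0 by rewrite mulmx0 mxE.
    apply/colP => i; rewrite mxE; move/eqP: v0; rewrite mxE psumr_eq0.
      by move/allP => /(_ i); rewrite mem_index_enum !mxE -expr2 sqrf_eq0 => /(_ isT)/eqP.
    by move=> j _; rewrite mxE -expr2 sqr_ge0.
  have := maxP _ (reflection_orth v0).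
  rewrite trace_mul_reflection gerBl pmulr_rge0 // divr_gt0 //.
  rewrite lt0r v0 mxE; apply: sumr_ge0 => j _; rewrite mxE -expr2; exact: sqr_ge0.
exists S; split => //; apply/matrixP => i j; rewrite mxE -/P.
have [->//|ij] := eqVneq i j.
pose u : 'cV[R]_n := delta_mx i 0; pose w : 'cV[R]_n := delta_mx j 0.
have uAv (A : 'M[R]_n) k l : bil (delta_mx k 0 : 'cV[R]_n) A (delta_mx l 0 : 'cV[R]_n) = A k l.
  by rewrite trmx_delta -rowE -colE !mxE.
have dot k l : ((delta_mx k 0 : 'cV[R]_n)^T *m (delta_mx l 0 : 'cV[R]_n)) 0 0 = (k == l)%:R.
  by rewrite -[(delta_mx k 0)^T]mulmx1 uAv mxE.
have eD (X Y : 'M[R]_1) : (X + Y) 0 0 = X 0 0 + Y 0 0 by rewrite mxE.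
have eZ a (X : 'M[R]_1) : (a *: X) 0 0 = a * X 0 0 by rewrite mxE.
(* The two reflections compose to a rotation in the plane of [u] and [w] by an angle of order [t].
   Maximality of the trace, multiplied by [(1 + t ^+ 2) / 2], bounds the first-order gain by a
   second-order term. *)
have key t : t * (P j i - P i j) <= t ^+ 2 * (P i i + P j j).
  pose v := u + t *: w.
  have vT : v^T = u^T + t *: w^T by rewrite linearD linearZ.
  have uu : (u^T *m u) 0 0 = 1 by rewrite dot eqxx.
  have vv : (v^T *m v) 0 0 = 1 + t ^+ 2.
    rewrite vT /v mulmxDl !mulmxDr -!scalemxAl -!scalemxAr ?(eD, eZ) !dot.
    by rewrite !eqxx (negbTE ij) eq_sym (negbTE ij) /=; ring.
  have q0 : 0 < 1 + t ^+ 2 by rewrite ltr_wpDr // sqr_ge0.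
  have uv : (u^T *m v) 0 0 = 1.
    by rewrite /v mulmxDr -scalemxAr ?(eD, eZ) !dot eqxx (negbTE ij) mulr0 addr0.
  have vPu : bil v P u = P i i + t * P j i.
    by rewrite vT !mulmxDl -!scalemxAl ?(eD, eZ) !uAv.
  have vPv : bil v P v = P i i + t * (P i j + P j i) + t ^+ 2 * P j j.
    rewrite vT !mulmxDl /v !mulmxDr -!scalemxAl -!scalemxAr ?(eD, eZ) !uAv; ring.
  have u0 : (u^T *m u) 0 0 != 0 by rewrite uu oner_neq0.
  have v0 : (v^T *m v) 0 0 != 0 by rewrite vv gt_eqF.
  have := maxP (reflection u *m reflection v).
  rewrite trmx_mul mulmxA -(mulmxA (reflection v)^T) reflection_orth // mulmx1.
  move=> /(_ (reflection_orth v0)).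
  rewrite mulmxA trace_mul_reflection bil_mul_reflection trace_mul_reflection.
  rewrite uu uv vPu vPv vv (uAv P i i) divr1 mulr1 => le.
  have {le}: (P i i + t * (P i j + P j i) + t ^+ 2 * P j j - 2 * (P i i + t * P j i))
     + (1 + t ^+ 2) * P i i >= 0.
    rewrite -(pmulr_rge0 _ (_ : 0 < 2 / (1 + t ^+ 2))) ?divr_gt0 //.
    rewrite mulrDr [X in _ + X](_ : _ = 2 * P i i); first by lra.
    by field; rewrite gt_eqF.
  by move=> le; lra.
apply/eqP; rewrite -subr_eq0; apply/eqP.
have [//|d0] := eqVneq (P j i - P i j) 0.
set d := P j i - P i j in key d0 *; set a := P i i + P j j in key.
have a0 : 0 <= a by rewrite addr_ge0 // -(uAv P) psd.
(* This single [t] replaces the limit: the two sides of [key] then differ by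
   [- d ^+ 2 / (a + 1) ^+ 2]. The [+ 1] keeps the denominator positive when [a = 0]. *)
have := key (d / (a + 1)).
rewrite -subr_ge0 (_ : _ - _ = - (d ^+ 2 / (a + 1) ^+ 2)); last first.
  by field; rewrite gt_eqF // ltr_wpDl.
by rewrite oppr_ge0 leNgt divr_gt0 // exprn_even_gt0 //= gt_eqF // ltr_wpDl.
Qed.

End Polar.

(** * The Frobenius norm and operator-norm bounds *)

Section Frobenius.
Variable R : realType.

Lemma sum_sqr_ge0 a b (X : 'M[R]_(a, b)) : 0 <= \sum_i \sum_j X i j ^+ 2.
Proof. by do 2!apply: sumr_ge0 => ? _; exact: sqr_ge0. Qed.

Lemma frob_ge0 a b (X : 'M[R]_(a, b)) : 0 <= frob X.
Proof. exact: sqrtr_ge0. Qed.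

Lemma sqr_frobE a b (X : 'M[R]_(a, b)) :
  frob X ^+ 2 = \sum_i \sum_j X i j ^+ 2.
Proof. by rewrite sqr_sqrtr // sum_sqr_ge0. Qed.

Lemma sqr_frob_trace a b (X : 'M[R]_(a, b)) : frob X ^+ 2 = \tr (X^T *m X).
Proof.
rewrite sqr_frobE exchange_big; apply: eq_bigr => j _; rewrite mxE.
by apply: eq_bigr => i _; rewrite mxE expr2.
Qed.

Lemma sqr_frob_col a b (X : 'M[R]_(a, b)) :
  frob X ^+ 2 = \sum_j frob (col j X) ^+ 2.
Proof.
rewrite sqr_frobE exchange_big; apply: eq_bigr => j _; rewrite sqr_frobE.
by apply: eq_bigr => i _; rewrite big_ord1 mxE.
Qed.

Lemma frob_eq0 a b (X : 'M[R]_(a, b)) : (frob X == 0) = (X == 0).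
Proof.
apply/eqP/eqP => [X0|->]; last first.
  by rewrite /frob big1 ?sqrtr0 // => i _; rewrite big1 // => j _; rewrite mxE expr0n.
apply/matrixP => i j; rewrite mxE.
have := sqr_frobE X; rewrite X0 expr0n /= => /esym/eqP.
rewrite psumr_eq0; last by move=> ? _; apply: sumr_ge0 => ? _; exact: sqr_ge0.
move/allP => /(_ i (mem_index_enum _)); rewrite psumr_eq0; last by move=> ? _; exact: sqr_ge0.
by move/allP => /(_ j (mem_index_enum _)); rewrite sqrf_eq0 => /eqP.
Qed.

Lemma frob_gt0 a b (X : 'M[R]_(a, b)) : (0 < frob X) = (X != 0).
Proof. by rewrite lt0r frob_ge0 andbT frob_eq0. Qed.

Lemma frob0 a b : frob (0 : 'M[R]_(a, b)) = 0.
Proof. by apply/eqP; rewrite frob_eq0. Qed.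

Lemma frobT a b (X : 'M[R]_(a, b)) : frob X^T = frob X.
Proof.
rewrite /frob exchange_big; congr Num.sqrt.
by apply: eq_bigr => i _; apply: eq_bigr => j _; rewrite mxE.
Qed.

Lemma frobZ a b c (X : 'M[R]_(a, b)) : frob (c *: X) = `|c| * frob X.
Proof.
apply/eqP; rewrite -(@eqrXn2 _ 2) ?mulr_ge0 ?frob_ge0 ?normr_ge0 //.
rewrite exprMn real_normK ?num_real // !sqr_frobE mulr_sumr.
apply/eqP/eq_bigr => i _; rewrite mulr_sumr; apply: eq_bigr => j _.
by rewrite mxE exprMn.
Qed.

Lemma frobN a b (X : 'M[R]_(a, b)) : frob (- X) = frob X.
Proof. by rewrite -scaleN1r frobZ normrN1 mul1r. Qed.

Lemma frob1 n : frob (1%:M : 'M[R]_n) = Num.sqrt n%:R.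
Proof.
apply/eqP; rewrite -(@eqrXn2 _ 2) ?sqrtr_ge0 ?frob_ge0 //.
by rewrite sqr_frob_trace trmx1 mulmx1 mxtrace1 sqr_sqrtr // ler0n.
Qed.

Lemma sqr_frobD a b (X Y : 'M[R]_(a, b)) :
  frob (X + Y) ^+ 2 = frob X ^+ 2 + 2 * \tr (X^T *m Y) + frob Y ^+ 2.
Proof.
rewrite !sqr_frob_trace [(X + Y)^T]linearD /= mulmxDl !mulmxDr !linearD /=.
by rewrite -(mxtrace_tr (Y^T *m X)) trmx_mul trmxK; ring.
Qed.

Lemma sqr_frobB a b (X Y : 'M[R]_(a, b)) :
  frob (X - Y) ^+ 2 = frob X ^+ 2 - 2 * \tr (X^T *m Y) + frob Y ^+ 2.
Proof. by rewrite sqr_frobD frobN mulmxN linearN /= mulrN. Qed.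

(** Cauchy-Schwarz for the trace inner product: expand the square of [frob Y *: X - frob X *: Y] and
    cancel [frob X * frob Y]. *)
Lemma trace_mul_le_frob a b (X Y : 'M[R]_(a, b)) :
  \tr (X^T *m Y) <= frob X * frob Y.
Proof.
have [/eqP|x0] := eqVneq (frob X) 0.
  by rewrite frob_eq0 => /eqP ->; rewrite trmx0 mul0mx linear0 frob0 mul0r.
have [/eqP|y0] := eqVneq (frob Y) 0.
  by rewrite frob_eq0 => /eqP ->; rewrite mulmx0 linear0 frob0 mulr0.
have xy : 0 < frob X * frob Y by rewrite mulr_gt0 // lt0r frob_ge0 ?x0 ?y0.
rewrite -(ler_pM2l xy).
have := sqr_ge0 (frob (frob Y *: X - frob X *: Y)).
rewrite sqr_frobB !frobZ !ger0_norm ?frob_ge0 // [(_ *: X)^T]linearZ /= -scalemxAl -scalemxAr.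
by rewrite !mxtraceZ; nra.
Qed.

Lemma frobD a b (X Y : 'M[R]_(a, b)) : frob (X + Y) <= frob X + frob Y.
Proof.
rewrite -(@ler_pXn2r _ 2) ?nnegrE ?addr_ge0 ?frob_ge0 // sqr_frobD.
by have := trace_mul_le_frob X Y; nra.
Qed.

Lemma frob_isometry a b k (V : 'M[R]_(a, b)) (X : 'M[R]_(b, k)) :
  V^T *m V = 1%:M -> frob (V *m X) = frob X.
Proof.
move=> VV; apply/eqP; rewrite -(@eqrXn2 _ 2) ?frob_ge0 // !sqr_frob_trace.
by rewrite trmx_mul mulmxA -(mulmxA X^T) VV mulmx1.
Qed.

Lemma frob_mulmx_ge a b k (X : 'M[R]_(a, b)) c (Y : 'M[R]_(b, k)) :
  0 <= c -> (forall v : 'cV[R]_b, c * frob v <= frob (X *m v)) ->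
  c * frob Y <= frob (X *m Y).
Proof.
move=> c0 cX; rewrite -(@ler_pXn2r _ 2) ?nnegrE ?mulr_ge0 ?frob_ge0 //.
rewrite exprMn !sqr_frob_col mulr_sumr; apply: ler_sum => j _.
rewrite -exprMn ler_pXn2r ?nnegrE ?mulr_ge0 ?frob_ge0 //.
by rewrite (colE j (X *m Y)) -mulmxA -colE; exact: cX.
Qed.

(** A bound rather than a value, so that it passes through sums, products and transposes without
    suprema. The sign of [c] is a separate clause because for [b = 0] the inequality does not
    constrain [c]. *)
Definition opnorm_le a b (X : 'M[R]_(a, b)) (c : R) : Prop :=
  0 <= c /\ forall v : 'cV[R]_b, frob (X *m v) <= c * frob v.

Lemma frob_mulmx_le a b k (X : 'M[R]_(a, b)) c (Y : 'M[R]_(b, k)) :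
  opnorm_le X c -> frob (X *m Y) <= c * frob Y.
Proof.
move=> [c0 Xc]; rewrite -(@ler_pXn2r _ 2) ?nnegrE ?mulr_ge0 ?frob_ge0 //.
rewrite exprMn !sqr_frob_col mulr_sumr; apply: ler_sum => j _.
rewrite -exprMn ler_pXn2r ?nnegrE ?mulr_ge0 ?frob_ge0 //.
by rewrite !colE -mulmxA; exact: Xc.
Qed.

(** The square of [frob (X^T *m v)] is the inner product of [v] with [X *m (X^T *m v)]; apply
    Cauchy-Schwarz and divide. *)
Lemma opnorm_le_trmx a b (X : 'M[R]_(a, b)) c :
  opnorm_le X c -> opnorm_le X^T c.
Proof.
move=> [c0 Xc]; split=> // v.
have [->|n0] := eqVneq (frob (X^T *m v)) 0; first by rewrite mulr_ge0 ?frob_ge0.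
have n1 : 0 < frob (X^T *m v) by rewrite lt0r n0 frob_ge0.
rewrite -(ler_pM2r n1) -expr2 sqr_frob_trace trmx_mul trmxK -mulmxA.
apply: le_trans (trace_mul_le_frob _ _) _.
by rewrite [c * _]mulrC -mulrA ler_wpM2l ?frob_ge0.
Qed.

Lemma frob_mulmx_ler a b k (X : 'M[R]_(a, b)) c (Y : 'M[R]_(k, a)) :
  opnorm_le X c -> frob (Y *m X) <= c * frob Y.
Proof.
move/opnorm_le_trmx => Xc.
by rewrite -frobT trmx_mul -(frobT Y); exact: frob_mulmx_le.
Qed.

Lemma opnorm_leD a b (X Y : 'M[R]_(a, b)) c d :
  opnorm_le X c -> opnorm_le Y d -> opnorm_le (X + Y) (c + d).
Proof.
move=> [c0 Xc] [d0 Yd]; split=> [|v]; first exact: addr_ge0.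
by rewrite mulmxDl mulrDl; apply: le_trans (frobD _ _) _; exact: lerD.
Qed.

Lemma opnorm_leN a b (X : 'M[R]_(a, b)) c :
  opnorm_le X c -> opnorm_le (- X) c.
Proof. by move=> [c0 Xc]; split=> // v; rewrite mulNmx frobN. Qed.

Lemma opnorm_leB a b (X Y : 'M[R]_(a, b)) c d :
  opnorm_le X c -> opnorm_le Y d -> opnorm_le (X - Y) (c + d).
Proof. by move=> Xc /opnorm_leN; exact: opnorm_leD. Qed.

Lemma opnorm_leM a b k (X : 'M[R]_(a, b)) (Y : 'M[R]_(b, k)) c d :
  opnorm_le X c -> opnorm_le Y d -> opnorm_le (X *m Y) (c * d).
Proof.
move=> Xc Yd; split=> [|v]; first by rewrite mulr_ge0 ?(proj1 Xc) ?(proj1 Yd).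
rewrite -mulmxA; apply: le_trans (frob_mulmx_le _ Xc) _.
by rewrite -mulrA ler_wpM2l ?(proj1 Xc) // (proj2 Yd).
Qed.

Lemma opnorm_le_isometry a b (V : 'M[R]_(a, b)) :
  V^T *m V = 1%:M -> opnorm_le V 1.
Proof. by move=> VV; split=> // v; rewrite frob_isometry // mul1r. Qed.

(** Cauchy-Schwarz on each row. It also shows that the set in [spectral_norm] is bounded, so that
    its [sup] is a genuine supremum. *)
Lemma opnorm_le_frob a b (X : 'M[R]_(a, b)) : opnorm_le X (frob X).
Proof.
split=> [|v]; first exact: frob_ge0.
rewrite -(@ler_pXn2r _ 2) ?nnegrE ?mulr_ge0 ?frob_ge0 // exprMn sqr_frobE.
rewrite [frob X ^+ 2]sqr_frobE mulr_suml; apply: ler_sum => i _; rewrite big_ord1.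
have -> : (X *m v) i 0 = \tr ((row i X)^T^T *m v) by rewrite trmxK -row_mul trace_mx11 [RHS]mxE.
have -> : \sum_j X i j ^+ 2 = frob (row i X)^T ^+ 2.
  by rewrite sqr_frobE; apply: eq_bigr => j _; rewrite big_ord1 !mxE.
rewrite -exprMn -[leRHS]ger0_norm ?sqr_ge0 // -[leLHS]ger0_norm ?sqr_ge0 //.
rewrite !normrX ler_pXn2r ?nnegrE ?normr_ge0 //.
rewrite [leRHS]ger0_norm ?mulr_ge0 ?frob_ge0 // ler_norml trace_mul_le_frob andbT.
by have := trace_mul_le_frob (row i X)^T (- v); rewrite frobN mulmxN linearN /= => h; rewrite lerNl.
Qed.

Lemma opnorm_le_spectral a b (X : 'M[R]_(a, b)) :
  opnorm_le X (spectral_norm X).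
Proof.
set E := [set frob (X *m v) | v in [set v : 'cV[R]_b | frob v <= 1]]%classic.
have ubE : ubound E (frob X).
  move=> _ [v /= v1 <-]; apply: le_trans (proj2 (opnorm_le_frob X) v) _.
  by rewrite ler_piMr ?frob_ge0.
have E0 : E 0 by exists 0; rewrite /= ?mulmx0 frob0.
have supE : has_sup E by split; [exists 0 | exists (frob X)].
have leE (v : 'cV[R]_b) : frob v <= 1 -> frob (X *m v) <= spectral_norm X.
  by move=> v1; apply: (ub_le_sup (proj2 supE)); exists v.
split=> [|v]; first by have := leE 0; rewrite mulmx0 !frob0; apply.
have [/eqP|n0] := eqVneq (frob v) 0.
  by rewrite frob_eq0 => /eqP ->; rewrite mulmx0 !frob0 mulr0.
have n1 : 0 < frob v by rewrite lt0r n0 frob_ge0.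
rewrite -ler_pdivrMr // mulrC -[_^-1]ger0_norm ?invr_ge0 ?frob_ge0 //.
rewrite -frobZ scalemxAr; apply: leE.
by rewrite frobZ ger0_norm ?invr_ge0 ?frob_ge0 // mulVf.
Qed.

End Frobenius.

(** * Singular values, truncation and low-rank differences *)

Section SingularValueBounds.
Variable R : realType.

Lemma sqr_frob_diag r (s : 'rV[R]_r) (y : 'cV[R]_r) :
  frob (diag_mx s *m y) ^+ 2 = \sum_i (s 0 i * y i 0) ^+ 2.
Proof.
by rewrite mul_diag_mx sqr_frobE; apply: eq_bigr => i _; rewrite big_ord1 mxE.
Qed.

(** The alternative [y i 0 = 0] lets the bound serve vectors supported on the leading singular
    directions only. *)
Lemma frob_diag_ge r (s : 'rV[R]_r) (y : 'cV[R]_r) c : 0 <= c ->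
  (forall i, y i 0 = 0 \/ c <= s 0 i) -> c * frob y <= frob (diag_mx s *m y).
Proof.
move=> c0 cs; rewrite -(@ler_pXn2r _ 2) ?nnegrE ?mulr_ge0 ?frob_ge0 //.
rewrite exprMn sqr_frob_diag sqr_frobE mulr_sumr; apply: ler_sum => i _.
rewrite big_ord1 exprMn; case: (cs i) => [->|ci]; first by rewrite expr0n !mulr0.
by rewrite ler_wpM2r ?sqr_ge0 // ler_pXn2r // nnegrE // (le_trans c0).
Qed.

Lemma frob_diag_le r (s : 'rV[R]_r) (y : 'cV[R]_r) c : 0 <= c ->
  (forall i, y i 0 = 0 \/ 0 <= s 0 i <= c) -> frob (diag_mx s *m y) <= c * frob y.
Proof.
move=> c0 cs; rewrite -(@ler_pXn2r _ 2) ?nnegrE ?mulr_ge0 ?frob_ge0 //.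
rewrite exprMn sqr_frob_diag sqr_frobE mulr_sumr; apply: ler_sum => i _.
rewrite big_ord1 exprMn; case: (cs i) => [->|/andP[s0 sc]].
  by rewrite expr0n !mulr0.
by rewrite ler_wpM2r ?sqr_ge0 // ler_pXn2r // nnegrE.
Qed.

Lemma opnorm_le_diag r (s : 'rV[R]_r) c : 0 <= c ->
  (forall i, 0 <= s 0 i <= c) -> opnorm_le (diag_mx s) c.
Proof. by move=> c0 cs; split=> // v; apply: frob_diag_le => // i; right. Qed.

Lemma kernel_vector (F : fieldType) a b (X : 'M[F]_(a, b)) :
  (\rank X < b)%N -> exists2 v : 'cV[F]_b, v != 0 & X *m v = 0.
Proof.
move=> rX; have : kermx X^T != 0.
  by rewrite kermx_eq0 /row_free mxrank_tr neq_ltn rX.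
move/rowV0Pn => [v /sub_kermxP vX v0]; exists v^T; first by rewrite trmx_eq0.
by apply: trmx_inj; rewrite trmx_mul trmxK trmx0.
Qed.

Lemma pid_mx_isometry n r : (n <= r)%N ->
  (pid_mx n : 'M[R]_(r, n))^T *m pid_mx n = 1%:M.
Proof. by move=> nr; rewrite tr_pid_mx pid_mx_id // pid_mx_1. Qed.

Lemma pid_mx_mul_eq0 n r (v : 'cV[R]_n) (i : 'I_r) :
  (n <= i)%N -> ((pid_mx n : 'M[R]_(r, n)) *m v) i 0 = 0.
Proof.
by move=> ni; rewrite mxE big1 // => j _; rewrite mxE ltnNge ni andbF mul0r.
Qed.

(** The first [n.+1] right singular vectors span a space too large for [K] to be injective on. On a
    nonzero vector there killed by [K], [X - K] acts as [X], which stretches it by at least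
    [s 0 k]. *)
Lemma svd_tail_le a b r n (X K : 'M[R]_(a, b)) U (s : 'rV[R]_r) V d (k : 'I_r) :
  is_svd X U s V -> (\rank K <= n)%N -> opnorm_le (X - K) d -> (n <= k)%N ->
  s 0 k <= d.
Proof.
move=> [UU VV s0 sd eX] rK Xd nk.
have nr : (n.+1 <= r)%N by apply: leq_ltn_trans nk _.
pose E : 'M[R]_(r, n.+1) := pid_mx n.+1.
have [|v v0 Kv] := @kernel_vector _ _ _ (K *m V *m E).
  by rewrite -mulmxA ltnS (leq_trans (mxrankM_maxl _ _)).
have fv : frob (V *m (E *m v)) = frob v.
  by rewrite !frob_isometry // pid_mx_isometry.
rewrite -(ler_pM2r (_ : 0 < frob v)) ?frob_gt0 // -{2}fv.
apply: le_trans (proj2 Xd _); rewrite mulmxBl (_ : K *m _ = 0) ?subr0; last by rewrite !mulmxA.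
rewrite eX -!mulmxA (mulmxA V^T) VV mul1mx frob_isometry //.
rewrite -fv frob_isometry //; apply: frob_diag_ge => // i.
have [ni|ik] := leqP n.+1 i; [left; exact: pid_mx_mul_eq0|right].
by apply: sd; apply: leq_trans nk; rewrite -ltnS.
Qed.

(** Optimality of truncation: [X - Y] keeps only the singular values of index at least [n], each
    bounded by [svd_tail_le]. *)
Lemma svd_truncation_opnorm_le n a b (X Y K : 'M[R]_(a, b)) d :
  svd_truncation n X Y -> (\rank K <= n)%N -> opnorm_le (X - K) d ->
  opnorm_le (X - Y) d.
Proof.
move=> [U [s [V [sX ->]]]] rK Xd; have d0 := proj1 Xd.
case: (sX) => UU VV s0 sd eX.
rewrite {1}eX -mulmxBl -mulmxBr -linearB -[d]mulr1 -[d]mul1r.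
apply: opnorm_leM; last exact/opnorm_le_trmx/opnorm_le_isometry.
apply: opnorm_leM; first exact: opnorm_le_isometry.
apply: opnorm_le_diag => // i; rewrite !mxE.
case: ltnP => ni; first by rewrite subrr lexx.
by rewrite subr0 s0 (svd_tail_le sX rK Xd).
Qed.

Lemma svd_truncation_id n a b (X Y : 'M[R]_(a, b)) :
  svd_truncation n X Y -> (\rank X <= n)%N -> Y = X.
Proof.
move=> XY rX; have X0 : opnorm_le (X - X) 0.
  by split=> // v; rewrite subrr mul0mx frob0 mul0r.
have := frob_mulmx_le 1%:M (svd_truncation_opnorm_le XY rX X0).
rewrite mulmx1 mul0r => le0; apply/esym/eqP.
by rewrite -subr_eq0 -frob_eq0 eq_le le0 frob_ge0.
Qed.

(** The columns of [V] are the first [n] right singular vectors. Existence of an SVD is read off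
    from [0 < sigma X n], which excludes the default values. *)
Lemma sigma_lower_bound n a b (X : 'M[R]_(a, b)) :
  (0 < n)%N -> 0 < sigma X n ->
  exists2 V : 'M[R]_(b, n), V^T *m V = 1%:M &
    forall x : 'cV[R]_n, sigma X n * frob x <= frob (X *m (V *m x)).
Proof.
rewrite /sigma => n0; set s := singular_values X.
have [nr|rn] := ltnP n.-1 (minn a b); last first.
  by rewrite nth_default ?ltxx // size_map size_enum_ord.
rewrite (nth_map (Ordinal nr)) ?size_enum_ord // .
rewrite (nth_ord_enum _ (Ordinal nr)); set k := Ordinal nr => sk0.
(* If there were no SVD, [xget] would return the default 0, against [sk0]. *)
have [U [V [UU VV s0 sd eX]]] : exists U V, is_svd X U s V.
  move: sk0; rewrite /s /singular_values.
  by case: xgetP => [y _ //|_]; rewrite mxE ltxx.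
have nr' : (n <= minn a b)%N by rewrite -(prednK n0).
exists (V *m pid_mx n); first by
  rewrite trmx_mul mulmxA -(mulmxA _ V^T) VV mulmx1 pid_mx_isometry.
move=> x; rewrite -(frob_isometry x (pid_mx_isometry nr')) -(mulmxA V) eX.
rewrite -!mulmxA (mulmxA V^T) VV mul1mx (frob_isometry _ UU).
apply: frob_diag_ge => [|i]; first exact: ltW.
have [ni|ik] := leqP n i; [left; exact: pid_mx_mul_eq0|right].
by apply: sd; rewrite -ltnS /= (prednK n0).
Qed.

(** Asking that [V^T *m (W *m x)] vanish off coordinate [i] is [n - 1] linear conditions on [n]
    unknowns. A nonzero solution is stretched by at least [c] under [K], yet by at most [s 0 i]
    under [L]. *)
Lemma svd_ge a b n (K L : 'M[R]_(a, b)) U (s : 'rV[R]_n) V W c e :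
  is_svd L U s V -> W^T *m W = 1%:M ->
  (forall x : 'cV[R]_n, c * frob x <= frob (K *m (W *m x))) ->
  opnorm_le (K - L) e -> forall i, c - e <= s 0 i.
Proof.
move=> [UU VV s0 sd eL] WW cK KLe i.
have [x x0 rx] : exists2 x : 'cV[R]_n, x != 0 &
    forall j, j != i -> (V^T *m (W *m x)) j 0 = 0.
  case: n U V W s UU VV WW s0 sd eL cK i => [|n] U V W s UU VV WW _ _ _ _ i.
    by case: i.
  have [|x x0 rx] := @kernel_vector _ _ _ (row' i (V^T *m W)).
    by rewrite ltnS rank_leq_row.
  exists x => // j; rewrite eq_sym => /unlift_some[l -> _].
  have <- : (row' i (V^T *m W) *m x) l 0 = 0 by rewrite rx mxE.
  by rewrite mulmxA [LHS]mxE [RHS]mxE; apply: eq_bigr => t _; rewrite [in RHS]mxE.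
have xgt0 : 0 < frob x by rewrite frob_gt0.
rewrite -(ler_pM2r xgt0) mulrBl lerBlDr.
apply: le_trans (cK x) _; rewrite addrC -[K](subrK L) mulmxDl.
apply: le_trans (frobD _ _) _; apply: lerD.
  by apply: le_trans (proj2 KLe _) _; rewrite frob_isometry.
rewrite eL -!mulmxA frob_isometry //.
apply: le_trans (frob_diag_le (c := s 0 i) _ _) _ => // [j|].
  by have [->|ji] := eqVneq j i; [right; rewrite s0 lexx | left; exact: rx].
rewrite ler_wpM2l // -(frob_isometry x WW) -[leRHS]mul1r.
exact: frob_mulmx_le (opnorm_le_trmx (opnorm_le_isometry VV)).
Qed.

(** Pythagoras for the orthogonal projection [U *m U^T]. *)
Lemma sqr_frob_compl a b k (U : 'M[R]_(a, b)) (Z : 'M[R]_(a, k)) :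
  U^T *m U = 1%:M ->
  frob (Z - U *m (U^T *m Z)) ^+ 2 = frob Z ^+ 2 - frob (U^T *m Z) ^+ 2.
Proof.
move=> UU; rewrite sqr_frobB frob_isometry // mulmxA -[Z^T *m U]trmxK.
by rewrite trmx_mul trmxK -sqr_frob_trace; ring.
Qed.

Lemma sqr_frob_cols a n (U : 'M[R]_(a, n)) :
  U^T *m U = 1%:M -> frob U ^+ 2 = n%:R.
Proof. by move=> UU; rewrite sqr_frob_trace UU mxtrace1. Qed.

(* The difference of two matrices of rank at most n has rank at most 2n. *)
Lemma sqr_frob_le_opnorm a b n (D : 'M[R]_(a, b)) (U X : 'M[R]_(a, n))
    (V Y : 'M[R]_(b, n)) e :
  U^T *m U = 1%:M -> V^T *m V = 1%:M -> D = U *m Y^T - X *m V^T ->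
  opnorm_le D e -> frob D ^+ 2 <= 2 * n%:R * e ^+ 2.
Proof.
move=> UU VV eD De; have e0 := proj1 De.
have sqr_le (z : R) c : 0 <= z -> z <= e * c -> 0 <= c -> c ^+ 2 = n%:R ->
    z ^+ 2 <= n%:R * e ^+ 2.
  by move=> z0 zc c0 <-; rewrite mulrC -exprMn ler_pXn2r ?nnegrE ?mulr_ge0.
have h1 : frob (U^T *m D) ^+ 2 <= n%:R * e ^+ 2.
  apply: (sqr_le _ (frob U)); rewrite ?frob_ge0 ?sqr_frob_cols //.
  by rewrite -(frobT U); exact: frob_mulmx_ler.
(* Off the range of [U] only the term in [V^T] survives, so [C] is recovered from [C *m V]. The
   range of [U] and its complement contribute [n * e ^+ 2] each. *)
pose C := D - U *m (U^T *m D).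
have CV : C = C *m V *m V^T.
  have -> : C = - (X - U *m (U^T *m X)) *m V^T.
    rewrite /C eD !mulmxBr !mulmxA mulNmx mulmxBl -(mulmxA U U^T U) UU mulmx1.
    by rewrite !opprB addrC addrA subrK.
  by rewrite -!mulmxA (mulmxA V^T) VV mul1mx.
have h2 : frob C ^+ 2 <= n%:R * e ^+ 2.
  have le1 : frob C ^+ 2 <= frob (D *m V) ^+ 2.
    apply: (@le_trans _ _ (frob (C *m V) ^+ 2)).
      rewrite {1}CV ler_pXn2r ?nnegrE ?frob_ge0 //.
      rewrite -[leRHS]mul1r; apply: frob_mulmx_ler.
      exact/opnorm_le_trmx/opnorm_le_isometry.
    rewrite /C mulmxBl -!mulmxA sqr_frob_compl // gerBl; exact: sqr_ge0.
  apply: le_trans le1 _; apply: (sqr_le _ (frob V)); rewrite ?frob_ge0 ?sqr_frob_cols //.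
  exact: frob_mulmx_le.
by move: h2; rewrite /C sqr_frob_compl //; lra.
Qed.

End SingularValueBounds.

(** * Moore-Penrose inverses and their perturbation *)

Section MoorePenroseBounds.
Variable R : realType.

Lemma mp_mul_orth a b (X : 'M[R]_(a, b)) Y (S : 'M[R]_b) :
  S^T *m S = 1%:M -> is_moore_penrose X Y -> is_moore_penrose (X *m S) (S^T *m Y).
Proof.
move=> SS [XYX YXY sXY sYX]; have SS' := mulmx1C SS.
have e : X *m S *m (S^T *m Y) = X *m Y.
  by rewrite mulmxA -(mulmxA X) SS' mulmx1.
split; rewrite ?e //.
- by rewrite mulmxA XYX.
- by rewrite -mulmxA e -mulmxA (mulmxA Y) YXY.
- by rewrite -!mulmxA (mulmxA Y) trmx_mul trmxK trmx_mul sYX !mulmxA.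
Qed.

Lemma mp_trmx a b (X : 'M[R]_(a, b)) Y :
  is_moore_penrose X Y -> is_moore_penrose X^T Y^T.
Proof.
by move=> [XYX YXY sXY sYX]; split; rewrite -!trmx_mul ?mulmxA ?XYX ?YXY ?sXY ?sYX.
Qed.

Lemma mp_invP a b (X : 'M[R]_(a, b)) Y :
  is_moore_penrose X Y -> is_moore_penrose X (mp_inv X).
Proof. by move=> XY; rewrite /mp_inv; apply: xgetPex; exists Y. Qed.

Lemma opnorm_le_proj n (P : 'M[R]_n) :
  P^T = P -> P *m P = P -> opnorm_le P 1.
Proof.
move=> PT PP; split=> // v; rewrite mul1r.
have [->|n0] := eqVneq (P *m v) 0; first by rewrite frob0 frob_ge0.
have n1 : 0 < frob (P *m v) by rewrite frob_gt0.
rewrite -(ler_pM2r n1) -expr2 sqr_frob_trace trmx_mul PT -mulmxA.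
by rewrite (mulmxA P) PP; exact: trace_mul_le_frob.
Qed.

(** The lower bound makes [X] injective, and [X] kills every column of [Y *m X - 1%:M]. *)
Lemma mp_left_inv a b (X : 'M[R]_(a, b)) Y c :
  0 < c -> (forall v : 'cV[R]_b, c * frob v <= frob (X *m v)) ->
  is_moore_penrose X Y -> Y *m X = 1%:M.
Proof.
move=> c0 cX [XYX _ _ _]; apply/eqP; rewrite -subr_eq0; apply/eqP.
apply/matrixP => i j; rewrite [RHS]mxE.
have /eqP : frob (col j (Y *m X - 1%:M)) = 0.
  apply/eqP; rewrite eq_le frob_ge0 andbT -(pmulr_rle0 _ c0).
  apply: le_trans (cX _) _.
  by rewrite colE mulmxA mulmxBr mulmx1 mulmxA XYX subrr mul0mx frob0.
by rewrite frob_eq0 => /eqP/colP/(_ i); rewrite !mxE.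
Qed.

(** [X *m Y] is an orthogonal projection, so [X] maps [Y *m v] to a vector no longer than [v]. *)
Lemma mp_opnorm_le a b (X : 'M[R]_(a, b)) Y c :
  0 < c -> (forall v : 'cV[R]_b, c * frob v <= frob (X *m v)) ->
  is_moore_penrose X Y -> opnorm_le Y c^-1.
Proof.
move=> c0 cX [XYX YXY sXY sYX]; split=> [|v]; first by rewrite invr_ge0 ltW.
rewrite -ler_pdivrMl ?invr_gt0 // invrK; apply: le_trans (cX _) _.
rewrite mulmxA -[leRHS]mul1r; apply: (proj2 (opnorm_le_proj sXY _)).
by rewrite mulmxA XYX.
Qed.

(** Wedin's identity, whose third term vanishes because [Y' *m Y = 1%:M]. The two remaining terms
    give the two summands of the constant; [Q] projects onto the complement of the range of [X]. *)
Lemma mp_perturb a b (X Y : 'M[R]_(a, b)) X' Y' c d :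
  0 < c -> (forall v : 'cV[R]_b, c * frob v <= frob (X *m v)) ->
  0 < d -> (forall v : 'cV[R]_b, d * frob v <= frob (Y *m v)) ->
  is_moore_penrose X X' -> is_moore_penrose Y Y' ->
  frob (X' - Y') <= (d^-1 ^+ 2 + d^-1 * c^-1) * frob (X - Y).
Proof.
move=> c0 cX d0 dY mX mY.
have X'X := mp_left_inv c0 cX mX; have Y'Y := mp_left_inv d0 dY mY.
have X'c := mp_opnorm_le c0 cX mX; have Y'd := mp_opnorm_le d0 dY mY.
case: (mX) => XXX _ sXX _; case: (mY) => _ YYY sYY _.
pose Q := 1%:M - X *m X'.
have QX : X^T *m Q = 0.
  by rewrite mulmxBr mulmx1 -sXX -trmx_mul XXX subrr.
have Y'E : Y' = Y' *m Y'^T *m Y^T by rewrite -mulmxA -trmx_mul sYY mulmxA.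
have -> : X' - Y' = Y' *m Y'^T *m (X - Y)^T *m Q - Y' *m (X - Y) *m X'.
  have -> : Y' *m Y'^T *m (X - Y)^T *m Q = - (Y' *m Q).
    by rewrite [(X - Y)^T]linearB /= -mulmxA mulmxBl QX sub0r mulmxN mulmxA -Y'E.
  have -> : Y' *m (X - Y) *m X' = Y' *m X *m X' - X'.
    by rewrite mulmxBr mulmxBl Y'Y mul1mx.
  by rewrite mulmxBr mulmx1 mulmxA !opprB [RHS]addrC addrA subrK.
apply: le_trans (frobD _ _) _; rewrite frobN mulrDl; apply: lerD.
  have Q1 : opnorm_le Q 1.
    apply: opnorm_le_proj; first by rewrite linearB /= trmx1 sXX.
    rewrite {1}/Q mulmxBl mul1mx (_ : X *m X' *m Q = 0) ?subr0 //.
    by rewrite /Q mulmxBr mulmx1 mulmxA XXX subrr.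
  apply: le_trans (frob_mulmx_ler _ Q1) _; rewrite mul1r -mulmxA.
  apply: le_trans (frob_mulmx_le _ Y'd) _.
  rewrite expr2 -mulrA ler_wpM2l ?invr_ge0 ?(ltW d0) //.
  apply: le_trans (frob_mulmx_le _ (opnorm_le_trmx Y'd)) _.
  by rewrite frobT.
apply: le_trans (frob_mulmx_ler _ X'c) _.
rewrite mulrAC [leRHS]mulrC ler_wpM2l ?invr_ge0 ?(ltW c0) //.
exact: frob_mulmx_le.
Qed.

End MoorePenroseBounds.

(** * The Procrustes estimate for balanced factors *)

Section Procrustes.
Variable R : realType.

Lemma trace_psd_ge0 n k (K : 'M[R]_n) (Z : 'M[R]_(n, k)) :
  (forall v : 'cV[R]_n, 0 <= bil v K v) -> 0 <= \tr (Z^T *m K *m Z).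
Proof.
move=> psd; apply: sumr_ge0 => j _.
suff -> : (Z^T *m K *m Z) j j = bil (col j Z) K (col j Z) by [].
rewrite tr_col -row_mul [LHS]mxE [RHS]mxE.
by apply: eq_bigr => i _; rewrite [X in _ = X * _]mxE [X in _ = _ * X]mxE.
Qed.

(* With u = A - K and v = B - K, the difference of the two sides is
   3/2 tr (K E) + |u|^2 / 4 + 3/4 |v|^2 + |u - v|^2 / 4. *)
Lemma procrustes_trace n (A B K E : 'M[R]_n) :
  A^T = A -> K^T = K -> E = A + B - 2 *: K -> 0 <= \tr (K *m E) ->
  \tr (A *m E) / 2 <= frob A ^+ 2 + frob B ^+ 2 - 2 * frob K ^+ 2.
Proof.
move=> sA sK -> .
rewrite !mulmxBr !mulmxDr -!scalemxAr !linearB /= !mxtraceZ !linearD /=.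
have -> : \tr (A *m A) = frob A ^+ 2 by rewrite sqr_frob_trace sA.
have -> : \tr (K *m K) = frob K ^+ 2 by rewrite sqr_frob_trace sK.
have := sqr_ge0 (frob (A - K)); rewrite sqr_frobB sA.
have := sqr_ge0 (frob (A - B)); rewrite sqr_frobB sA.
have := sqr_ge0 (frob (K - B)); rewrite sqr_frobB sK.
by rewrite (mxtrace_mulC K A); lra.
Qed.

(** Stack [Z = [O; Q^T]] and [Zh = [Oh; Qh^T]]. By balance [A] and [B] are the Gram matrices of [Z]
    and [Zh S]; [K] is [Z^T Zh S], symmetric positive semidefinite by the choice of [S], and [E] is
    the Gram matrix of [Z - Zh S]. *)
Lemma procrustes a b n (O Oh : 'M[R]_(a, n)) (Q Qh : 'M[R]_(n, b)) c :
  0 <= c -> (forall v : 'cV[R]_n, c * frob v <= frob (O *m v)) ->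
  O^T *m O = Q *m Q^T -> Oh^T *m Oh = Qh *m Qh^T ->
  exists2 S : 'M[R]_n, S^T *m S = 1%:M &
    c ^+ 2 * (frob (O - Oh *m S) ^+ 2 + frob (Q - S^T *m Qh) ^+ 2)
      <= 4 * frob (O *m Q - Oh *m Qh) ^+ 2.
Proof.
move=> c0 cO bal balh.
pose P1 := O^T *m Oh; pose P2 := Q *m Qh^T.
have [S [SS sK psd]] := polar_exists (P1 + P2).
have SS' := mulmx1C SS.
exists S => //; set D1 := O - Oh *m S; set D2 := Q - S^T *m Qh.
pose D := O^T *m O; pose Dh := Oh^T *m Oh.
pose A := 2 *: D; pose B := 2 *: (S^T *m Dh *m S); pose K := (P1 + P2) *m S.
pose E := D1^T *m D1 + D2 *m D2^T.
have sD : D^T = D by rewrite trmx_mul trmxK.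
have EE : E = A + B - 2 *: K.
  have e1 : D1^T *m D1 = D + S^T *m Dh *m S - (P1 *m S + (P1 *m S)^T).
    rewrite /D1 [(O - _)^T]linearB /= mulmxBl !mulmxBr /D /Dh /P1 !trmx_mul trmxK.
    by rewrite !mulmxA opprB addrACA -opprD.
  have e2 : D2 *m D2^T = D + S^T *m Dh *m S - (P2 *m S + (P2 *m S)^T).
    rewrite /D2 [(Q - _)^T]linearB /= mulmxBl !mulmxBr /D /Dh /P2 bal balh !trmx_mul.
    by rewrite !trmxK !mulmxA opprB addrACA -opprD.
  have eK : P1 *m S + (P1 *m S)^T + (P2 *m S + (P2 *m S)^T) = 2 *: K.
    have KT : K^T = (P1 *m S)^T + (P2 *m S)^T by rewrite /K mulmxDl linearD.
    by rewrite addrACA -KT sK -mulmxDl -/K scaler_nat mulr2n.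
  by rewrite /E e1 e2 addrACA -opprD eK /A /B !scaler_nat !mulr2n addrACA.
have KE : 0 <= \tr (K *m E).
  rewrite /E mulmxDr linearD /=; apply: addr_ge0.
    have -> : \tr (K *m (D1^T *m D1)) = \tr (D1^T^T *m K *m D1^T).
      by rewrite trmxK mulmxA mxtrace_mulC mulmxA.
    exact: trace_psd_ge0.
  by rewrite mulmxA mxtrace_mulC mulmxA; exact: trace_psd_ge0.
have sA : A^T = A by rewrite linearZ /= sD.
have := procrustes_trace sA sK EE KE.
have AE : c ^+ 2 * (frob D1 ^+ 2 + frob D2 ^+ 2) <= \tr (A *m E) / 2.
  rewrite /A /E -scalemxAl mxtraceZ [2 * _]mulrC mulfK ?pnatr_eq0 //.
  rewrite mulmxDr linearD /= mulrDr; apply: lerD.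
    have -> : \tr (D *m (D1^T *m D1)) = frob (O *m D1^T) ^+ 2.
      by rewrite sqr_frob_trace trmx_mul trmxK mulmxA mxtrace_mulC !mulmxA.
    by rewrite -exprMn ler_pXn2r ?nnegrE ?mulr_ge0 ?frob_ge0 // -frobT frob_mulmx_ge.
  have -> : \tr (D *m (D2 *m D2^T)) = frob (O *m D2) ^+ 2.
    by rewrite sqr_frob_trace trmx_mul mulmxA mxtrace_mulC !mulmxA.
  by rewrite -exprMn ler_pXn2r ?nnegrE ?mulr_ge0 ?frob_ge0 // frob_mulmx_ge.
(* Replacing one of the two Gram factors in the trace by [Y *m Y^T] turns it into the trace for the
   product [X *m Y]. *)
have fbal (X : 'M[R]_(a, n)) (Y : 'M[R]_(n, b)) : X^T *m X = Y *m Y^T ->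
    frob (X^T *m X) ^+ 2 = frob (X *m Y) ^+ 2.
  move=> XY; rewrite !sqr_frob_trace !trmx_mul trmxK {2}XY.
  by rewrite [RHS]mxtrace_mulC !mulmxA mxtrace_mulC !mulmxA.
have frobS (X : 'M[R]_n) : frob (X *m S) = frob X.
  by rewrite -frobT trmx_mul frob_isometry ?frobT // trmxK.
have -> : frob A ^+ 2 = 4 * frob (O *m Q) ^+ 2.
  by rewrite /A frobZ exprMn normr_nat /D (fbal _ _ bal); congr (_ * _); ring.
have -> : frob B ^+ 2 = 4 * frob (Oh *m Qh) ^+ 2.
  rewrite /B frobZ exprMn normr_nat frobS frob_isometry ?trmxK // (fbal _ _ balh).
  by congr (_ * _); ring.
have -> : frob K ^+ 2 = frob (P1 + P2) ^+ 2 by rewrite /K frobS.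
(* This gives [4 * \tr (P1^T *m P2) <= frob (P1 + P2) ^+ 2], and that trace is the inner product of
   [O *m Q] and [Oh *m Qh]. *)
have := sqr_ge0 (frob (P1 - P2)); rewrite (sqr_frobB P1) (sqr_frobD P1).
have : \tr ((O *m Q)^T *m (Oh *m Qh)) = \tr (P1^T *m P2).
  rewrite /P1 /P2 -[RHS]mxtrace_tr !trmx_mul !trmxK.
  by rewrite !mulmxA [LHS]mxtrace_mulC !mulmxA.
by rewrite (sqr_frobB (O *m Q)) => ->; lra.
Qed.

End Procrustes.

(** * Norms of blocks and of matrices with a block column removed *)

Section Blocks.
Variable R : realType.

Lemma sqr_frob_mxrow a t (q : 'I_t -> nat) (B : forall j, 'M[R]_(a, q j)) :
  frob (\mxrow_j B j) ^+ 2 = \sum_j frob (B j) ^+ 2.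
Proof.
rewrite -frobT sqr_frob_trace trmxK tr_mxrow mul_mxrow_mxcol linear_sum /=.
by apply: eq_bigr => j _; rewrite -(frobT (B j)) sqr_frob_trace trmxK.
Qed.

Lemma frob_submxrow_le a t (q : 'I_t -> nat) (X : 'M[R]_(a, \sum_i q i)) j :
  frob (submxrow X j) <= frob X.
Proof.
rewrite -(@ler_pXn2r _ 2) ?nnegrE ?frob_ge0 // -{2}[X]submxrowK sqr_frob_mxrow.
by rewrite (bigD1 j) //= lerDl; apply: sumr_ge0 => i _; exact: sqr_ge0.
Qed.

Lemma frob_submxcol_le a t (q : 'I_t -> nat) (X : 'M[R]_(\sum_i q i, a)) j :
  frob (submxcol X j) <= frob X.
Proof. by rewrite -frobT tr_submxcol -(frobT X) frob_submxrow_le. Qed.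

(** After transposition, dropping a block column only removes coordinates from [v^T *m X]. The cases
    [i = ord_max] and [i = ord0] are [hminus] and [hplus]. *)
Lemma opnorm_le_drop_block a t p (i : 'I_t.+1)
    (X : 'M[R]_(a, \sum_(j < t.+1) p)) c :
  opnorm_le X c -> opnorm_le (\mxrow_(j < t) submxrow X (lift i j)) c.
Proof.
move=> Xc; set Y := \mxrow_j _; rewrite -[Y]trmxK; apply: opnorm_le_trmx.
split=> [|v]; first exact: (proj1 Xc).
rewrite -(frobT v); apply: le_trans (frob_mulmx_ler v^T Xc).
rewrite -frobT trmx_mul trmxK /Y mul_mxrow.
rewrite -(@ler_pXn2r _ 2) ?nnegrE ?frob_ge0 // -[v^T *m X]submxrowK !sqr_frob_mxrow.
under eq_bigr do rewrite mul_submxrow.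
rewrite [leRHS](bigD1_ord i) //=.
by rewrite lerDr sqr_ge0.
Qed.

Lemma hminusB a t p (X Y : 'M[R]_(a, \sum_(j < t.+1) p)) :
  hminus X - hminus Y = hminus (X - Y).
Proof. by rewrite /hminus -mxrowB; apply: eq_mxrow => j; rewrite submxrowB. Qed.

Lemma hplusB a t p (X Y : 'M[R]_(a, \sum_(j < t.+1) p)) :
  hplus X - hplus Y = hplus (X - Y).
Proof. by rewrite /hplus -mxrowB; apply: eq_mxrow => j; rewrite submxrowB. Qed.

End Blocks.

(** * Balanced factors obtained from an SVD *)

Section BalancedFactors.
Variables (R : realType) (a b n : nat).
Variables (L : 'M[R]_(a, b)) (U : 'M[R]_(a, n)) (s : 'rV[R]_n) (V : 'M[R]_(b, n)).
Hypothesis svdL : is_svd L U s V.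

Let d := map_mx Num.sqrt s.
Let O := U *m diag_mx d.
Let Q := diag_mx d *m V^T.

Lemma diag_sqrt_mul : diag_mx d *m diag_mx d = diag_mx s.
Proof.
rewrite mulmx_diag; congr diag_mx; apply/rowP => i; rewrite !mxE -expr2 sqr_sqrtr //.
exact: svd_ge0 svdL i.
Qed.

Lemma balanced_mul : O *m Q = L.
Proof.
rewrite /O /Q mulmxA -(mulmxA U) diag_sqrt_mul; exact/esym/(svd_eq svdL).
Qed.

Lemma balanced_gram : O^T *m O = Q *m Q^T.
Proof.
rewrite /O /Q !trmx_mul trmxK tr_diag_mx -!mulmxA (mulmxA U^T) (mulmxA V^T).
by rewrite (svd_U svdL) (svd_V svdL) !mul1mx.
Qed.

Lemma balanced_lower c : 0 <= c -> (forall i, c ^+ 2 <= s 0 i) ->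
  (forall v : 'cV[R]_n, c * frob v <= frob (O *m v)) /\
  (forall v : 'cV[R]_n, c * frob v <= frob (Q^T *m v)).
Proof.
move=> c0 cs; have cd i : c <= d 0 i.
  by rewrite mxE -[c]ger0_norm // -sqrtr_sqr ler_wsqrtr.
split=> v; rewrite /O /Q ?trmx_mul ?trmxK ?tr_diag_mx -mulmxA frob_isometry.
- by apply: frob_diag_ge => // i; right.
- exact: svd_U svdL.
- by apply: frob_diag_ge => // i; right.
- exact: svd_V svdL.
Qed.

(** Inverting the square roots of the singular values gives explicit inverses of [O] and [Q], so
    [mp_inv] does not fall back on its default. *)
Lemma balanced_mp : (forall i, 0 < s 0 i) ->
  is_moore_penrose O (mp_inv O) /\ is_moore_penrose Q (mp_inv Q).
Proof.
move=> s0; pose e := map_mx GRing.inv d.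
have de : diag_mx d *m diag_mx e = 1%:M.
  rewrite mulmx_diag -diag_const_mx; congr diag_mx; apply/rowP => i.
  by rewrite !mxE mulfV // sqrtr_eq0 -ltNge.
have ed : diag_mx e *m diag_mx d = 1%:M by rewrite diag_mxC.
have OE : O *m (diag_mx e *m U^T) = U *m U^T.
  by rewrite /O mulmxA -(mulmxA U) de mulmx1.
have EO : diag_mx e *m U^T *m O = 1%:M.
  by rewrite /O mulmxA -(mulmxA _ U^T) (svd_U svdL) mulmx1.
have QE : Q *m (V *m diag_mx e) = 1%:M.
  by rewrite /Q mulmxA -(mulmxA _ V^T) (svd_V svdL) mulmx1.
have EQ : V *m diag_mx e *m Q = V *m V^T.
  by rewrite /Q mulmxA -(mulmxA V) ed mulmx1.
split.
  apply: (@mp_invP _ _ _ _ (diag_mx e *m U^T)).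
  split; rewrite ?EO ?OE ?mul1mx ?trmx1 ?trmx_mul ?trmxK //.
  by rewrite -OE -mulmxA EO mulmx1.
apply: (@mp_invP _ _ _ _ (V *m diag_mx e)).
split; rewrite ?EQ ?QE ?mul1mx ?trmx1 ?trmx_mul ?trmxK //.
by rewrite -EQ -mulmxA QE mulmx1.
Qed.

End BalancedFactors.

(** * Perturbation of the state matrix *)

Section StatePerturbation.
Variable R : realType.

(* The three terms of the telescoped difference are bounded by 45/4, 3/4 and
   675/32 times [q * h / r ^+ 3]. *)
Lemma state_perturb a b n (O O' : 'M[R]_(a, n)) X X' (Q Q' : 'M[R]_(n, b)) Y Y'
    (K K' : 'M[R]_(a, b)) h del r q :
  0 < r -> 0 <= h -> 0 <= del -> q = Num.sqrt (n%:R * del) ->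
  r ^+ 2 <= h -> del <= r ^+ 2 / 4 ->
  (forall v : 'cV[R]_n, r * frob v <= frob (O *m v)) ->
  (forall v : 'cV[R]_n, r * frob v <= frob (Q^T *m v)) ->
  (forall v : 'cV[R]_n, (2 / 3 * r) * frob v <= frob (O' *m v)) ->
  (forall v : 'cV[R]_n, (2 / 3 * r) * frob v <= frob (Q'^T *m v)) ->
  is_moore_penrose O X -> is_moore_penrose O' X' ->
  is_moore_penrose Q Y -> is_moore_penrose Q' Y' ->
  opnorm_le K h -> opnorm_le (K - K') del ->
  frob (O - O') <= 3 * q -> frob (Q - Q') <= 3 * q ->
  frob (X *m K *m Y - X' *m K' *m Y') <= 50 * q * h / r ^+ 3.
Proof.
move=> r0 h0 del0 eq rh dr rO rQ rO' rQ' mO mO' mQ mQ' Kh KK' dO dQ.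
have q0 : 0 <= q by rewrite eq sqrtr_ge0.
have r'0 : 0 < 2 / 3 * r by rewrite mulr_gt0 // divr_gt0.
have ri0 : 0 < r^-1 by rewrite invr_gt0.
have X'le : opnorm_le X' (3 / 2 * r^-1).
  have := mp_opnorm_le r'0 rO' mO'; congr (opnorm_le _ _).
  by field; rewrite gt_eqF.
have Yle : opnorm_le Y r^-1.
  rewrite -[Y]trmxK; apply: opnorm_le_trmx.
  exact: mp_opnorm_le r0 rQ (mp_trmx mQ).
(* The constant of [mp_perturb]: [9/4 + 3/2 = 15/4]. With factors differing by at most [3 * q] it
   yields [45/4] below. *)
have coef : ((2 / 3 * r)^-1 ^+ 2 + (2 / 3 * r)^-1 * r^-1) = 15 / 4 * r^-1 ^+ 2.
  by field; rewrite gt_eqF.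
have dX : frob (X - X') <= 45 / 4 * r^-1 ^+ 2 * q.
  have := mp_perturb r0 rO r'0 rO' mO mO'; rewrite coef => /le_trans; apply.
  by have := ler_wpM2l (exprn_ge0 2 (ltW ri0)) dO; lra.
have dY : frob (Y - Y') <= 45 / 4 * r^-1 ^+ 2 * q.
  rewrite -frobT linearB /=.
  have := mp_perturb r0 rQ r'0 rQ' (mp_trmx mQ) (mp_trmx mQ').
  rewrite coef => /le_trans; apply; rewrite -linearB frobT.
  by have := ler_wpM2l (exprn_ge0 2 (ltW ri0)) dQ; lra.
have K'le : opnorm_le K' (5 / 4 * h).
  have := opnorm_leB Kh KK'; rewrite opprB addrC subrK => -[_ K'le].
  split=> [|v]; first by lra.
  by apply: le_trans (K'le v) _; rewrite ler_wpM2r ?frob_ge0 //; lra.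
have -> : X *m K *m Y - X' *m K' *m Y' =
    (X - X') *m (K *m Y) + X' *m ((K - K') *m Y) + X' *m K' *m (Y - Y').
  rewrite !mulmxBl !mulmxBr !mulmxA.
  by rewrite 2!addrA !subrK.
pose w := q * h * r^-1 ^+ 3.
have t1 : frob ((X - X') *m (K *m Y)) <= 45 / 4 * w.
  apply: le_trans (frob_mulmx_ler _ (opnorm_leM Kh Yle)) _.
  by have := ler_wpM2l (mulr_ge0 h0 (ltW ri0)) dX; rewrite /w !exprS expr0; lra.
have t2 : frob (X' *m ((K - K') *m Y)) <= 3 / 4 * w.
  apply: le_trans (frob_mulmx_le _ X'le) _.
  (* The identity, of Frobenius norm [Num.sqrt n%:R], converts the operator bound into a Frobenius
     bound. One factor [Num.sqrt del] then joins [q], and the other is at most [r / 2]. *)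
  rewrite -[_ *m Y]mulmx1.
  have := frob_mulmx_le 1%:M (opnorm_leM KK' Yle); rewrite frob1 => le1.
  have nd : Num.sqrt n%:R * del <= q * (r / 2).
    have -> : Num.sqrt n%:R * del = q * Num.sqrt del.
      by rewrite eq sqrtrM ?ler0n // -mulrA -expr2 sqr_sqrtr.
    rewrite ler_wpM2l // -[r / 2]ger0_norm ?divr_ge0 ?(ltW r0) // -sqrtr_sqr.
    by rewrite ler_wsqrtr // exprMn exprVn; lra.
  have hr : r^-1 <= h * r^-1 ^+ 3.
    rewrite -(ler_pM2l (exprn_gt0 3 r0)).
    have -> : r ^+ 3 / r = r ^+ 2 by field; rewrite gt_eqF.
    by have -> : r ^+ 3 * (h * r^-1 ^+ 3) = h by field; rewrite gt_eqF.
  have le2 := ler_wpM2l (ltW (exprn_gt0 2 ri0)) nd.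
  have e2 : r^-1 ^+ 2 * (q * (r / 2)) = q * r^-1 / 2 by field; rewrite gt_eqF.
  have le3 := ler_wpM2l q0 hr.
  have le4 := ler_wpM2l (ltW ri0) le1.
  rewrite /w; lra.
have t3 : frob (X' *m K' *m (Y - Y')) <= 675 / 32 * w.
  apply: le_trans (frob_mulmx_le _ (opnorm_leM X'le K'le)) _.
  have c0 : 0 <= 3 / 2 * r^-1 * (5 / 4 * h) by apply: mulr_ge0; lra.
  by have := ler_wpM2l c0 dY; rewrite /w !exprS expr0; lra.
have w0 : 0 <= w by apply: mulr_ge0; [exact: mulr_ge0 | rewrite exprn_ge0 // ltW].
have -> : 50 * q * h / r ^+ 3 = 50 * w by rewrite /w exprVn; ring.
(* The three coefficients add up to [1059/32], less than 50. *)
apply: le_trans (frobD _ _) _.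
by have := frobD ((X - X') *m (K *m Y)) (X' *m ((K - K') *m Y)); lra.
Qed.

End StatePerturbation.

(** * Assembly of the two bounds *)

Lemma powR_3half (R : realType) (x : R) : 0 <= x ->
  x `^ (3%:R / 2%:R) = Num.sqrt x ^+ 3.
Proof.
by move=> x0; rewrite mulrC powRrM powR12_sqrt // powR_mulrn // sqrtr_ge0.
Qed.

(** Test the lower bound of [sigma_lower_bound] on the all-ones vector, nonzero since [0 < n]. It
    supplies the hypothesis [r ^+ 2 <= h] of [state_perturb]. *)
Lemma sigma_le_opnorm (R : realType) n a b (X : 'M[R]_(a, b)) c :
  (0 < n)%N -> 0 < sigma X n -> opnorm_le X c -> sigma X n <= c.
Proof.
move=> n0 s0 Xc; have [V VV sV] := sigma_lower_bound n0 s0.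
have x0 : 0 < frob (const_mx 1 : 'cV[R]_n).
  rewrite frob_gt0; apply/eqP => /colP/(_ (Ordinal n0)).
  by rewrite !mxE => /eqP; rewrite oner_eq0.
rewrite -(ler_pM2r x0); apply: le_trans (sV _) _.
by apply: le_trans (proj2 Xc _) _; rewrite frob_isometry.
Qed.

Theorem corollary5p4 (R : realType) (n m p T1 T2 : nat)
    (hn : (0 < n)%N) (hT1 : (0 < T1)%N) (hT2 : (0 < T2)%N)
    (A : 'M[R]_n) (B : 'M[R]_(n, p)) (C : 'M[R]_(m, n)) (D : 'M[R]_(m, p))
    (G Ghat : 'M[R]_(m, \sum_(k < (T1 + T2).+1) p))
    (L Lhat : 'M[R]_(\sum_(i < T1) m, \sum_(j < T2) p))
    (O Ohat : 'M[R]_(\sum_(i < T1) m, n))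
    (Q Qhat : 'M[R]_(n, \sum_(j < T2) p))
    (Abar Ahat : 'M[R]_n) (Bbar Bhat : 'M[R]_(n, p))
    (Cbar Chat : 'M[R]_(m, n)) :
  let H := hankel G in
  let Hhat := hankel Ghat in
  let delta := spectral_norm (H - Hhat) in
  controllable A B ->
  observable A C ->
  G = markov_params (T1 + T2).+1 A B C D ->
  \rank (hminus H) = n ->
  ho_kalman hT1 hT2 G L O Q Abar Bbar Cbar ->
  ho_kalman hT1 hT2 Ghat Lhat Ohat Qhat Ahat Bhat Chat ->
  0 < sigma L n ->
  delta <= sigma L n / 4%:R ->
  exists S : 'M[R]_n,
    S^T *m S = 1%:M /\
    Num.max (frob (Cbar - Chat *m S))
      (Num.max (frob (O - Ohat *m S))
        (Num.max (frob (Bbar - S^T *m Bhat))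
                 (frob (Q - S^T *m Qhat))))
      <= 5%:R * Num.sqrt (n%:R * delta) /\
    frob (Abar - S^T *m Ahat *m S)
      <= 50%:R * Num.sqrt (n%:R * delta) * spectral_norm H
         / (sigma L n `^ (3%:R / 2%:R)).
Proof.
move=> H Hhat delta _ _ _ rkH [tL [U [s [V [svdL [eO [eQ [eC [eB eA]]]]]]]]].
move=> [tLh [Uh [sh [Vh [svdLh [eOh [eQh [eCh [eBh eAh]]]]]]]]] s0 dle.
rewrite -/H in tL eA; rewrite -/Hhat in tLh eAh.
have eL : L = hminus H by apply: svd_truncation_id tL _; rewrite rkH.
have HH := opnorm_le_spectral (H - Hhat); rewrite -/delta in HH.
have d0 : 0 <= delta := proj1 HH.
have Hm : opnorm_le (hminus H - hminus Hhat) delta.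
  by rewrite hminusB; exact: opnorm_le_drop_block.
have Hp : opnorm_le (hplus H - hplus Hhat) delta.
  by rewrite hplusB; exact: opnorm_le_drop_block.
(* Go through [hminus Hhat]: its truncation [Lhat] is at least as close to it as the rank-[n] matrix
   [hminus H], which is within [delta]. *)
have LLh : opnorm_le (L - Lhat) (2 * delta).
  have Hm' : opnorm_le (hminus Hhat - hminus H) delta.
    by rewrite -opprB; exact: opnorm_leN.
  have le1 := svd_truncation_opnorm_le tLh (eq_leq rkH) Hm'.
  have := opnorm_leD Hm le1; rewrite addrA subrK -eL.
  by rewrite (_ : 2 * delta = delta + delta) //; ring.
have [W WW sW] := sigma_lower_bound hn s0.
set sg := sigma L n in s0 dle sW *.
(* With zero perturbation, [svd_ge] relates the diagonal [s] of the SVD chosen in the run to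
   [sigma L n]. *)
have hLL : opnorm_le (L - L) 0.
  by split=> // v; rewrite subrr mul0mx frob0 mul0r.
have sge i : sg <= s 0 i by have := svd_ge svdL WW sW hLL i; rewrite subr0.
have shge i : sg / 2 <= sh 0 i.
  by apply: le_trans (svd_ge svdLh WW sW LLh i); lra.
pose r := Num.sqrt sg.
have r0 : 0 < r by rewrite sqrtr_gt0.
have r2 : r ^+ 2 = sg by rewrite sqr_sqrtr // ltW.
have sc i : r ^+ 2 <= s 0 i by rewrite r2.
(* [2 / 3] is a rational lower bound for the square root of [1 / 2], as [4/9 <= 1/2]. *)
have shc i : (2 / 3 * r) ^+ 2 <= sh 0 i.
  by apply: le_trans (shge i); rewrite exprMn r2; lra.
have r'0 : 0 <= 2 / 3 * r by lra.
have [lO lQ] := balanced_lower svdL (ltW r0) sc.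
have [lOh lQh] := balanced_lower svdLh r'0 shc.
have [mO mQ] := balanced_mp svdL (fun i => lt_le_trans s0 (sge i)).
have [mOh mQh] := balanced_mp svdLh
  (fun i => lt_le_trans (divr_gt0 s0 (ltr0Sn _ 1)) (shge i)).
have gO := balanced_gram svdL; have gOh := balanced_gram svdLh.
have OQ := balanced_mul svdL; have OQh := balanced_mul svdLh.
rewrite -eO -?eQ in lO lQ mO mQ gO OQ.
rewrite -eOh -?eQh in lOh lQh mOh mQh gOh OQh.
have [S SS dist] := procrustes (ltW r0) lO gO gOh.
have SS' := mulmx1C SS.
have fL : frob (L - Lhat) ^+ 2 <= 2 * n%:R * (2 * delta) ^+ 2.
  apply: (sqr_frob_le_opnorm (U := U) (V := Vh) (Y := V *m diag_mx s)
    (X := Uh *m diag_mx sh)) => //.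
  - exact: svd_U svdL.
  - exact: svd_V svdLh.
  - by rewrite trmx_mul tr_diag_mx mulmxA -(svd_eq svdL) -(svd_eq svdLh).
exists S; split=> //.
set q := Num.sqrt (n%:R * delta).
have nd0 : 0 <= n%:R * delta by rewrite mulr_ge0 // ler0n.
have q0 : 0 <= q by rewrite sqrtr_ge0.
have q2 : q ^+ 2 = n%:R * delta by rewrite sqr_sqrtr.
(* The Procrustes bound is [32 * n * delta ^+ 2], at most [8 * sg * q ^+ 2] since [delta <= sg / 4].
   The 8 is rounded up to 9 to have an exact square root. *)
have dist2 : frob (O - Ohat *m S) ^+ 2 + frob (Q - S^T *m Qhat) ^+ 2 <= 9 * q ^+ 2.
  rewrite -(ler_pM2l s0); apply: le_trans (_ : _ <= sg * (8 * q ^+ 2)) _.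
    rewrite -{1}r2; apply: le_trans dist _; rewrite OQ OQh q2.
    by have := ler_wpM2l nd0 dle; move: fL; lra.
  by rewrite ler_wpM2l ?(ltW s0) //; have := sqr_ge0 q; lra.
have dO : frob (O - Ohat *m S) <= 3 * q.
  rewrite -(@ler_pXn2r _ 2) ?nnegrE ?frob_ge0 ?mulr_ge0 // exprMn.
  by have := sqr_ge0 (frob (Q - S^T *m Qhat)); lra.
have dQ : frob (Q - S^T *m Qhat) <= 3 * q.
  rewrite -(@ler_pXn2r _ 2) ?nnegrE ?frob_ge0 ?mulr_ge0 // exprMn.
  by have := sqr_ge0 (frob (O - Ohat *m S)); lra.
have q35 : 3 * q <= 5 * q by lra.
split.
  rewrite !ge_max (le_trans dO q35) (le_trans dQ q35) !andbT eC eCh eB eBh.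
  rewrite submxcol_mul -submxcolB mul_submxrow -submxrowB.
  rewrite (le_trans (frob_submxcol_le _ _) (le_trans dO q35)).
  by rewrite (le_trans (frob_submxrow_le _ _) (le_trans dQ q35)).
have Hh := opnorm_le_spectral H.
rewrite powR_3half ?(ltW s0) // -/r.
(* The conjugated state matrix is the algorithm's product for the rotated factors [Ohat *m S] and
   [S^T *m Qhat], whose pseudoinverses are the outer factors here. *)
have -> : S^T *m Ahat *m S = (S^T *m mp_inv Ohat) *m hplus Hhat *m (mp_inv Qhat *m S).
  by rewrite eAh !mulmxA.
rewrite eA; apply: (state_perturb (O := O) (O' := Ohat *m S) (Q := Q)
  (Q' := S^T *m Qhat) (del := delta)) => //.
- exact: proj1 Hh.
- by rewrite r2; apply: sigma_le_opnorm => //; rewrite eL; exact: opnorm_le_drop_block.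
- by rewrite r2.
- by move=> v; rewrite -mulmxA -{1}(frob_isometry v SS); exact: lOh.
- by move=> v; rewrite trmx_mul trmxK -mulmxA -{1}(frob_isometry v SS); exact: lQh.
- exact: mp_mul_orth.
- rewrite -[S^T *m Qhat]trmxK -[mp_inv _ *m S]trmxK; apply: mp_trmx.
  rewrite trmx_mul trmxK [(mp_inv _ *m S)^T]trmx_mul.
  by apply: mp_mul_orth => //; exact: mp_trmx.
- exact: opnorm_le_drop_block.
Qed.
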